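(* Let $d\ge1$, $\gamma\in\big[0,\frac{d+1}{2}\big)$, and let $g(r)=r^{-\gamma}$ or $g(r)=(1\vee r)^{-\gamma}$ (so that, for $m>0$, $f(x)=e^{-m|x|}g(|x|)$ is a density on $\mathbb{R}^d$). Then $$H_n(r)\le\frac{\Gamma\big(\frac{d+1}{2}-\gamma\big)^n}{\Gamma\big((\frac{d+1}{2}-\gamma)n\big)}\,r^{(\frac{d+1}{2}-\gamma)(n-1)},\qquad r\ge0,\ n\in\mathbb{N}.$$
   Context: $\mathbb{N}=\{1,2,\dots\}$, $a\vee b=\max(a,b)$, $0^0=1$. The functions $H_n:[0,\infty)\to[0,\infty)$ are defined by $H_1\equiv1$ on $[0,\infty)$ and, for $n\in\mathbb{N}$, $H_{n+1}\equiv0$ on $[0,2]$ and $$H_{n+1}(r):=\frac{1}{g(r)\,r^{\frac{d-1}{2}}}\int_1^{r-1}g(r-\rho)(r-\rho)^{\frac{d-1}{2}}g(\rho)\rho^{\frac{d-1}{2}}H_n(\rho)\,d\rho,\qquad r>2.$$ *)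

(* Defs.v *)
From HB Require Import structures.
From mathcomp Require Import all_boot all_order all_algebra.
From mathcomp Require Import all_classical all_reals all_analysis.

Set Implicit Arguments.
Unset Strict Implicit.
Unset Printing Implicit Defensive.

Import Order.TTheory GRing.Theory Num.Theory.
Import numFieldNormedType.Exports.

Local Open Scope classical_set_scope.
Local Open Scope ring_scope.

(* Euler's Gamma function; only meaningful for s > 0, where the integral
   converges. *)
Definition Gamma (R : realType) (s : R) : R :=
  \int[lebesgue_measure]_(t in `]0, +oo[) (t `^ (s - 1) * expR (- t)).

(* The map h |-> H_{n+1} when h = H_n. In the integral both rho and r - rho
   range over [1, r - 1], so g is only ever evaluated at arguments >= 1. *)
Definition H_step (R : realType) (d : nat) (g h : R -> R) (r : R) : R :=
  if r <= 2 then 0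
  else (g r * r `^ ((d%:R - 1) / 2))^-1 *
    \int[lebesgue_measure]_(rho in `[1, r - 1])
      (g (r - rho) * (r - rho) `^ ((d%:R - 1) / 2) *
       g rho * rho `^ ((d%:R - 1) / 2) * h rho).

(* Indexed from n = 1: H_1 = 1 and H_{n+1} = H_step H_n for n >= 1; the value
   at n = 0 is a dummy. The values at r < 0 are irrelevant. *)
Definition H (R : realType) (d : nat) (g : R -> R) (n : nat) : R -> R :=
  iter n.-1 (H_step d g) (fun=> 1).

(* Main.v *)
Require Import Defs.
From mathcomp Require Import all_boot all_order all_algebra.
From mathcomp Require Import all_classical all_reals all_analysis.
From mathcomp Require Import measurable_realfun ring lra.

Set Implicit Arguments.
Unset Strict Implicit.
Unset Printing Implicit Defensive.

Import Order.TTheory GRing.Theory Num.Theory.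
Import numFieldNormedType.Exports.

Local Open Scope classical_set_scope.
Local Open Scope ring_scope.

(** Put a = (d+1)/2 - gamma > 0.  Both choices of g agree with r^(-gamma) on
    [1, oo[, which is where the recursion evaluates g, so the weight
    g(r) r^((d-1)/2) equals r^(a-1) there and
    [[
      H_{n+1}(r) = r^(1-a) \int_1^{r-1} (r - s)^(a-1) s^(a-1) H_n(s) ds.
    ]]
    If H_n(s) <= C_n s^(a(n-1)), enlarging the domain to ]0, r[ bounds the
    integral by C_n times the convolution of the powers t^(a-1) and t^(an-1)
    at r.  By scaling this convolution is r^(a+an-1) times its value at 1
    ([powconvE]), and that value is the Beta integral
    Gamma(a) Gamma(an) / Gamma(a+an) ([powconv1E]).  Hence
    C_{n+1} = C_n Gamma(a) Gamma(an) / Gamma(a(n+1)); starting from C_1 = 1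
    the product telescopes to C_n = Gamma(a)^n / Gamma(an).

    The Beta identity comes from Tonelli's theorem ([eGammaM]): write
    Gamma(a) Gamma(b) as a double integral and substitute u = s + t, so that
    exp(-u) factors out of the inner convolution.  All this is done with
    extended-real integrals over the whole line of functions cut off outside
    ]0, oo[, where no convergence has to be known; convergence enters only
    through 0 < Gamma(a) < oo, that is [eGamma_lty] and [Gamma_gt0], which
    makes the division legitimate. *)

(** * Integrals of nonnegative functions *)

(** The integral of a nonnegative function is a supremum over the simple
    functions below it, hence monotone even on non-measurable functions.  This
    spares a proof that the iterates H_n are measurable. *)
Lemma ge0_le_integral_nomeas d (T : measurableType d) (R : realType)
    (mu : {measure set T -> \bar R}) (D : set T) (f g : T -> \bar R) :
  (forall x, D x -> 0 <= f x)%E -> (forall x, D x -> f x <= g x)%E ->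
  (\int[mu]_(x in D) f x <= \int[mu]_(x in D) g x)%E.
Proof.
move=> f0 fg.
rewrite !ge0_integralE//; last by move=> x Dx; exact: le_trans (f0 _ Dx) (fg _ Dx).
apply: ereal_sup_le => _ [h hf <-]; exists h => // x.
by apply: le_trans (hf x) _; rewrite /patch; case: ifPn => // /set_mem; exact: fg.
Qed.

(** Scaling the image of Lebesgue measure under x |-> c x + v by c gives a
    measure with the right values on intervals, so it is Lebesgue measure. *)
Lemma ge0_integral_affine (R : realType) (f : R -> \bar R) (c v : R) :
  0 < c -> measurable_fun [set: R] f -> (forall x, 0 <= f x)%E ->
  (\int[lebesgue_measure]_x f x =
   c%:E * \int[lebesgue_measure]_x f (c * x + v)%R)%E.
Proof.
move=> c0 mf f0.
pose phi : measurableTypeR R -> measurableTypeR R := fun x => c * x + v.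
have mphi : measurable_fun setT phi.
  by apply: measurable_funD => //; apply: measurable_funM.
(* The measure structure of an image measure depends on the proof mphi that the
   map is measurable, hence the explicit instance. *)
pose nu : {measure set (measurableTypeR R) -> \bar R} :=
    measure_function_pushforward__canonical__measure_function_Measure
      lebesgue_measure mphi.
have munu A : measurable A ->
    mscale (NngNum (ltW c0)) nu A = @lebesgue_measure R A.
  move=> mA; apply/esym/lebesgue_measure_unique => //= _ [[a b]] _ <-.
  rewrite /mscale/= /pushforward.
  have -> : phi @^-1` `]a, b]%classic = `](a - v) / c, (b - v) / c]%classic.
    apply/seteqP; split => x /=; rewrite !in_itv/= /phi;
      by rewrite ltr_pdivrMr// ler_pdivlMr// ltrBlDr lerBrDr mulrC.
  rewrite !lebesgue_measure_itv/= !lte_fin ltr_pM2r ?invr_gt0// ltrD2r.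
  case: ifPn => _; last by rewrite mule0.
  by rewrite -!EFinD -EFinM; congr EFin; field; rewrite gt_eqF.
transitivity (\int[mscale (NngNum (ltW c0)) nu]_x f x)%E.
  by apply: eq_measure_integral => A mA _; exact/esym/munu.
rewrite ge0_integral_mscale//=; congr (_ * _)%E.
exact: ge0_integral_pushforward.
Qed.

(** * Convolutions of powers and the Beta integral *)

(** Cutting t^(a-1) off outside ]0, oo[ puts the limits of integration into the
    integrand, so that translations and Tonelli's theorem apply on the whole
    line. *)
Definition pospow (R : realType) (a : R) : R -> R :=
  (fun t => t `^ (a - 1)) \_ `]0, +oo[.

Lemma pospowE (R : realType) (a t : R) : 0 < t -> pospow a t = t `^ (a - 1).
Proof. by move=> t0; rewrite /pospow patchE mem_set//= in_itv/= t0. Qed.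

Lemma pospow_le0 (R : realType) (a t : R) : t <= 0 -> pospow a t = 0.
Proof.
by move=> t0; rewrite /pospow patchE memNset//= in_itv/= andbT; apply/negP; rewrite -leNgt.
Qed.

Lemma pospow_ge0 (R : realType) (a t : R) : 0 <= pospow a t.
Proof.
by have [t0|t0] := leP t 0; [rewrite pospow_le0|rewrite pospowE// powR_ge0].
Qed.

Lemma measurable_pospow (R : realType) (a : R) : measurable_fun [set: R] (pospow a).
Proof.
by apply/(measurable_restrictT _ _).1 => //; apply: measurable_funTS; exact: measurable_powR.
Qed.

Lemma pospowM (R : realType) (a u t : R) : 0 < u ->
  pospow a (u * t) = u `^ (a - 1) * pospow a t.
Proof.
move=> u0; have [t0|t0] := leP t 0.
  by rewrite !pospow_le0 ?mulr0// pmulr_rle0.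
by rewrite !pospowE ?mulr_gt0// powRM// ltW.
Qed.

(** Euler's Gamma integral, kept in the extended reals until it is known to
    converge. *)
Definition eGamma (R : realType) (a : R) : \bar R :=
  (\int[lebesgue_measure]_t (pospow a t * expR (- t))%:E)%E.

Definition powconv (R : realType) (a b u : R) : \bar R :=
  (\int[lebesgue_measure]_t (pospow a (u - t) * pospow b t)%:E)%E.

Lemma eGamma_ge0 (R : realType) (a : R) : (0 <= eGamma a)%E.
Proof.
by apply: integral_ge0 => t _; rewrite lee_fin mulr_ge0 ?expR_ge0 ?pospow_ge0.
Qed.

Lemma powconv_ge0 (R : realType) (a b u : R) : (0 <= powconv a b u)%E.
Proof.
by apply: integral_ge0 => t _; rewrite lee_fin mulr_ge0 ?pospow_ge0.
Qed.

Lemma measurable_powconv_integrand (R : realType) (a b u : R) :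
  measurable_fun [set: R] (fun t => pospow a (u - t) * pospow b t).
Proof.
apply: measurable_funM; last exact: measurable_pospow.
apply: measurableT_comp; first exact: measurable_pospow.
exact: measurable_funB.
Qed.

Lemma measurable_eGamma_integrand (R : realType) (a : R) :
  measurable_fun [set: R] (fun t => pospow a t * expR (- t)).
Proof.
apply: measurable_funM; first exact: measurable_pospow.
exact: measurableT_comp.
Qed.

(** Substituting t = u s in the convolution takes out the factor
    u * u^(a-1) * u^(b-1). *)
Lemma powconvE (R : realType) (a b u : R) :
  powconv a b u = ((pospow (a + b) u)%:E * powconv a b 1)%E.
Proof.
have [u0|u0] := leP u 0.
  rewrite pospow_le0// mul0e; apply: integral0_eq => t _.
  have [t0|t0] := leP t 0; first by rewrite (pospow_le0 _ t0)// mulr0.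
  by rewrite pospow_le0 ?mul0r// subr_le0; exact: le_trans (ltW t0).
rewrite /powconv (ge0_integral_affine 0 u0)//; last 2 first.
- apply/measurable_EFinP; exact: measurable_powconv_integrand.
- by move=> t; rewrite lee_fin mulr_ge0 ?pospow_ge0.
under eq_integral => t _.
  rewrite addr0 -{1}[u]mulr1 -mulrBr !pospowM// mulrACA EFinM.
  over.
rewrite ge0_integralZl_EFin//=; last 3 first.
- by move=> t _; rewrite lee_fin mulr_ge0 ?pospow_ge0.
- apply/measurable_EFinP; exact: measurable_powconv_integrand.
- by rewrite mulr_ge0 ?powR_ge0.
rewrite muleA -EFinM pospowE//; congr (_%:E * _)%E.
rewrite -{1}(powRr1 (ltW u0)) -!powRD ?(gt_eqF u0) ?implybT//.
by congr (_ `^ _); ring.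
Qed.

(** The Beta identity: after the shift s = u - t the double integral for
    Gamma(a) Gamma(b) has the integrand (u-t)^(a-1) t^(b-1) exp(-u); integrate
    it over t before u. *)
Lemma eGammaM (R : realType) (a b : R) :
  (eGamma a * eGamma b = powconv a b 1 * eGamma (a + b))%E.
Proof.
have mG (c : R) := (measurable_EFinP _ _).2 (@measurable_eGamma_integrand R c).
have G0 (c t : R) : (0 <= (pospow c t * expR (- t))%:E)%E.
  by rewrite lee_fin mulr_ge0 ?expR_ge0 ?pospow_ge0.
pose F (z : measurableTypeR R * measurableTypeR R) : \bar R :=
  (pospow a (z.2 - z.1) * pospow b z.1 * expR (- z.2))%:E.
have mF : measurable_fun setT F.
  apply/measurable_EFinP; apply: measurable_funM; first apply: measurable_funM.
  - apply: measurableT_comp; first exact: measurable_pospow.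
    by apply: measurable_funB; [exact: measurable_snd|exact: measurable_fst].
  - by apply: measurableT_comp; [exact: measurable_pospow|exact: measurable_fst].
  - apply: measurableT_comp => //; apply: measurableT_comp => //.
have F0 z : (0 <= F z)%E by rewrite lee_fin !mulr_ge0 ?expR_ge0 ?pospow_ge0.
transitivity (\int[lebesgue_measure]_t \int[lebesgue_measure]_u F (t, u))%E.
  rewrite [X in (_ * X = _)%E]/eGamma -ge0_integralZl//; last 2 first.
  - exact: mG.
  - exact: eGamma_ge0.
  apply: eq_integral => t _.
  have -> : (eGamma a = \int[lebesgue_measure]_u
      (pospow a (u - t) * expR (- (u - t)))%:E)%E.
    rewrite /eGamma (ge0_integral_affine (- t) ltr01 (mG a) (G0 a)) mul1e.
    by apply: eq_integral => u _; rewrite mul1r.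
  rewrite muleC -ge0_integralZl_EFin//=; last 2 first.
  - have mtr : measurable_fun [set: R] (fun u : R => u - t) by exact: measurable_funB.
    exact: (measurableT_comp (mG a) mtr).
  - by rewrite mulr_ge0 ?expR_ge0 ?pospow_ge0.
  apply: eq_integral => u _; rewrite /F/= -EFinM; congr EFin.
  have -> : expR (- u) = expR (- t) * expR (- (u - t)).
    by rewrite -expRD; congr expR; ring.
  by ring.
rewrite (fubini_tonelli F)//.
rewrite /eGamma -ge0_integralZl//; last 2 first.
- exact: mG.
- exact: powconv_ge0.
apply: eq_integral => u _; rewrite /F/=.
under eq_integral do rewrite mulrC EFinM.
rewrite ge0_integralZl_EFin//=; last 2 first.
- by move=> t _; rewrite lee_fin mulr_ge0 ?pospow_ge0.
- apply/measurable_EFinP; exact: measurable_powconv_integrand.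
by rewrite -/(powconv a b u) powconvE muleA -EFinM mulrC muleC.
Qed.

(** * Convergence and positivity of the Gamma integral *)

(** The primitive t^a / a bounds the integral over [1/(n+1), 1] by 1/a for every
    n, and these intervals exhaust ]0, 1]. *)
Lemma integral_pow_near0 (R : realType) (a : R) : 0 < a ->
  (\int[lebesgue_measure]_(t in `]0%R, 1%R]) (t `^ (a - 1))%:E <= (a^-1)%:E)%E.
Proof.
move=> a0; pose F n : set (measurableTypeR R) := `[0 + n.+1%:R^-1, 1]%classic.
have -> : `]0%R, 1%R]%classic = \bigcup_n F n.
  by have := itv_open_bnd_bigcup false (1 : R) 0.
have inv_gt0 n : 0 < 0 + (n.+1%:R : R)^-1 by rewrite add0r invr_gt0 ltr0n.
have cvgI := ge0_nondecreasing_set_cvg_integral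
  (mu := @lebesgue_measure R) (F := F) (f := fun t : R => (t `^ (a - 1))%:E).
rewrite -(cvg_lim _ (cvgI _ _ _ _))//; last 4 first.
- move=> m n mn; apply/subsetPset; apply: subset_itvr; rewrite bnd_simp.
  by rewrite lerD2l lef_pV2 ?posrE ?ltr0n// ler_nat.
- by move=> n; exact: measurable_itv.
- move=> n; apply/measurable_EFinP/measurable_funTS; exact: measurable_powR.
- by move=> n x _; rewrite lee_fin powR_ge0.
apply: lime_le.
  apply: ereal_nondecreasing_is_cvgn => m n mn; apply: ge0_subset_integral => //.
  - exact: measurable_itv.
  - exact: measurable_itv.
  - apply/measurable_EFinP/measurable_funTS; exact: measurable_powR.
  - by move=> x _; rewrite lee_fin powR_ge0.
  - apply: subset_itvr; rewrite bnd_simp.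
    by rewrite lerD2l lef_pV2 ?posrE ?ltr0n// ler_nat.
apply: nearW => n; rewrite /F; have := inv_gt0 n.
have : 0 + n.+1%:R^-1 <= 1 :> R by rewrite add0r invf_le1 ?ltr0n// ler1n.
set e := 0 + _ => e1 e0.
(* For n = 0 the interval is reduced to the point 1. *)
move: e1; rewrite le_eqVlt => /predU1P[->|e1].
  by rewrite set_itv1 integral_set1 lee_fin invr_ge0 ltW.
have dF (x : R) : 0 < x -> is_derive x 1 (fun t : R => a^-1 * t `^ a) (x `^ (a - 1)).
  move=> x0; have dx := is_derive1_powR a x0.
  by apply: is_derive_eq; rewrite /GRing.scale/= mulrA mulVf ?lt0r_neq0// mul1r.
have dF' (x : R) : 0 < x -> {for x, continuous (fun t : R => a^-1 * t `^ a)}.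
  move=> x0; have dx := dF _ x0.
  by apply/differentiable_continuous/derivable1_diffP.
have cf (x : R) : 0 < x -> {for x, continuous (fun t : R => t `^ (a - 1))}.
  move=> x0; have dx := is_derive1_powR (a - 1) x0.
  by apply/differentiable_continuous/derivable1_diffP.
rewrite (@continuous_FTC2 _ _ (fun t => a^-1 * t `^ a))//.
- rewrite -EFinB lee_fin powR1 mulr1 lerBlDr lerDl.
  by rewrite mulr_ge0 ?powR_ge0// invr_ge0 ltW.
- apply: continuous_in_subspaceT => x /set_mem/=; rewrite in_itv/= => /andP[ex _].
  by apply: cf; apply: lt_le_trans ex.
- split.
  + move=> x; rewrite in_itv/= => /andP[ex _].
    by have := dF _ (lt_trans e0 ex).
  + by apply: cvg_at_right_filter; exact: dF'.
  + by apply: cvg_at_left_filter; apply: dF'.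
- move=> x; rewrite in_itv/= => /andP[ex _]; rewrite derive1E.
  by have dx := dF _ (lt_trans e0 ex); rewrite derive_val.
Qed.

(** From s <= exp(s) at s = t/(2a) follows (t/(2a))^a <= exp(t/2), so half of
    the exponential decay absorbs the power. *)
Lemma powR_le_expR (R : realType) (a t : R) : 0 < a -> 1 <= t ->
  t `^ (a - 1) * expR (- t) <= (2 * a) `^ a * expR (- (t / 2)).
Proof.
move=> a0 t1; have t0 : 0 < t by apply: lt_le_trans t1.
apply: (@le_trans _ _ (t `^ a * expR (- t))).
  rewrite ler_wpM2r ?expR_ge0// ler_powR//; lra.
have -> : expR (- t) = expR (- (t / 2)) * expR (- (t / 2)).
  by rewrite -expRD; congr expR; field.
rewrite mulrA ler_wpM2r ?expR_ge0//.
rewrite -ler_pdivlMr ?expR_gt0// -expRN opprK.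
have a20 : 0 < 2 * a by rewrite mulr_gt0.
have -> : t / 2 = t / (2 * a) * a by field; rewrite gt_eqF.
rewrite expRM.
have -> : t `^ a = (2 * a) `^ a * (t / (2 * a)) `^ a.
  by rewrite -powRM ?divr_ge0 ?ltW//; congr (_ `^ _); field; rewrite gt_eqF.
rewrite ler_wpM2l ?powR_ge0// ge0_ler_powR ?nnegrE ?expR_ge0 ?divr_ge0 ?ltW//.
by rewrite (lt_le_trans _ (expR_ge1Dx _))// ltrDr.
Qed.

(** The integrand is dominated by t^(a-1) on ]0, 1] and, beyond 1, by a multiple
    of the density of the exponential law of rate 1/2. *)
Lemma eGamma_lty (R : realType) (a : R) : 0 < a -> (eGamma a < +oo)%E.
Proof.
move=> a0.
pose f (t : R) := ((powR (R:=R) ^~ (a - 1)) \_ `]0, 1]) t.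
pose C : R := 2 * (2 * a) `^ a.
have C0 : 0 <= C by rewrite mulr_ge0 ?powR_ge0.
have f0 t : 0 <= f t by rewrite /f patchE; case: ifP => // _; exact: powR_ge0.
have mf : measurable_fun [set: R] f.
  by apply/(measurable_restrictT _ _).1 => //; apply: measurable_funTS; exact: measurable_powR.
have e0 t : 0 <= exponential_pdf (2^-1 : R) t by rewrite exponential_pdf_ge0.
have h0 : 0 < (2^-1 : R) by rewrite invr_gt0.
apply: (@le_lt_trans _ _ (\int[lebesgue_measure]_t
    ((f t)%:E + C%:E * (exponential_pdf (2^-1 : R) t)%:E))%E).
  apply: ge0_le_integral_nomeas => t _.
    by rewrite lee_fin mulr_ge0 ?expR_ge0 ?pospow_ge0.
  rewrite -EFinM -EFinD lee_fin.
  have [t0|t0] := leP t 0.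
    by rewrite pospow_le0// mul0r addr_ge0// mulr_ge0.
  rewrite pospowE//; have [t1|t1] := leP t 1.
    rewrite /f patchE mem_set/= ?in_itv/= ?t0//.
    apply: ler_wpDr; first by rewrite mulr_ge0.
    by rewrite ler_piMr ?powR_ge0// -expR0 ler_expR oppr_le0 ltW.
  apply: ler_wpDl => //; apply: (le_trans (powR_le_expR a0 (ltW t1))).
  rewrite exponential_pdfE ?(ltW t0)// le_eqVlt; apply/orP; left; apply/eqP.
  rewrite mulrA; congr (_ * expR _); first by rewrite /C; field.
  by rewrite mulNr mulrC.
rewrite ge0_integralD//=; last 4 first.
- by move=> t _; rewrite lee_fin.
- exact/measurable_EFinP.
- by move=> t _; rewrite -EFinM lee_fin mulr_ge0.
- apply/measurable_EFinP; apply: measurable_funM => //.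
  exact: measurable_exponential_pdf.
rewrite ge0_integralZl_EFin//=; last 2 first.
- by move=> t _; rewrite lee_fin.
- apply/measurable_EFinP; exact: measurable_exponential_pdf.
rewrite integral_exponential_pdf// mule1.
apply: lte_add_pinfty; last exact: ltry.
apply: le_lt_trans (ltry a^-1); apply: le_trans (integral_pow_near0 a0).
rewrite [leRHS]integral_mkcond; apply: ge0_le_integral_nomeas => t _.
  by rewrite lee_fin.
by rewrite /f !patchE; case: ifP.
Qed.

Lemma EFin_Gamma (R : realType) (a : R) : 0 < a -> (Gamma a)%:E = eGamma a.
Proof.
move=> a0; rewrite /Gamma /Rintegral.
have -> : (\int[lebesgue_measure]_(t in `]0%R, +oo[) (t `^ (a - 1) * expR (- t))%:E)%E
    = eGamma a.
  rewrite integral_mkcond; apply: eq_integral => t _.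
  by rewrite /pospow !patchE; case: ifP => //; rewrite mul0r.
by rewrite fineK// ge0_fin_numE ?eGamma_lty// eGamma_ge0.
Qed.

(** On [1, 2] the integrand is at least t^(-1) exp(-t) >= exp(-2) / 2, because
    a - 1 > -1. *)
Lemma Gamma_gt0 (R : realType) (a : R) : 0 < a -> 0 < Gamma a.
Proof.
move=> a0; rewrite -lte_fin EFin_Gamma//.
pose c : R := 2^-1 * expR (- 2).
have c0 : 0 < c by rewrite mulr_gt0 ?expR_gt0// invr_gt0.
apply: (@lt_le_trans _ _ (\int[lebesgue_measure]_(t in `[1%R, 2%R]) (cst c%:E) t)%E).
  rewrite integral_cst//= lebesgue_measure_itv/= lte_fin ltr1n/= -EFinD -EFinM lte_fin.
  by rewrite mulr_gt0//; lra.
rewrite integral_mkcond; apply: ge0_le_integral_nomeas => t _.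
  by rewrite patchE; case: ifP => // _; rewrite lee_fin ltW.
rewrite patchE; case: ifPn => [/set_mem/=|_]; last first.
  by rewrite lee_fin mulr_ge0 ?expR_ge0 ?pospow_ge0.
rewrite in_itv/= => /andP[t1 t2]; have t0 : 0 < t by apply: lt_le_trans t1.
rewrite lee_fin pospowE// ler_pM ?expR_ge0 ?invr_ge0//; last by rewrite ler_expR lerN2.
apply: (@le_trans _ _ (t `^ (-1))).
  by rewrite powR_inv1 ?(ltW t0)// lef_pV2 ?posrE.
by rewrite ler_powR//; lra.
Qed.

(** * The bound on the iterates *)

(** Since Gamma(a+b) is positive and Gamma(a) Gamma(b) finite, the identity of
    [eGammaM] also forces the convolution to be finite. *)
Lemma powconv1E (R : realType) (a b : R) : 0 < a -> 0 < b ->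
  powconv a b 1 = (Gamma a * Gamma b / Gamma (a + b))%:E.
Proof.
move=> a0 b0; have ab0 := addr_gt0 a0 b0; have Gab := Gamma_gt0 ab0.
have := eGammaM a b; rewrite -!EFin_Gamma//.
case: powconv (powconv_ge0 a b 1) => [k||//] _.
- by rewrite -!EFinM => -[->]; rewrite mulfK// gt_eqF.
- by rewrite gt0_mulye// lte_fin.
Qed.

(** One step of the recursion on power bounds.  The exponent is written b - a so
    that multiplication by the weight s^(a-1) produces s^(b-1), the second
    factor of the Beta integral.  The lower bound 0 is part of the statement
    because the comparison of integrals needs nonnegative integrands. *)
Lemma H_step_bound (R : realType) (d : nat) (g h : R -> R) (a b C : R) :
  0 < a -> 0 < b -> 0 <= C ->
  (forall r, 1 <= r -> g r * r `^ ((d%:R - 1) / 2) = r `^ (a - 1)) ->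
  (forall r, 0 <= r -> 0 <= h r <= C * r `^ (b - a)) ->
  forall r, 0 <= r ->
  0 <= H_step d g h r <= C * (Gamma a * Gamma b / Gamma (a + b)) * r `^ b.
Proof.
move=> a0 b0 C0 gE hC r r0.
set B := Gamma a * _ / _.
have B0 : 0 <= B by rewrite divr_ge0 ?mulr_ge0 ?ltW ?Gamma_gt0 ?addr_gt0.
rewrite /H_step; case: ifPn => [_|]; first by rewrite lexx (mulr_ge0 (mulr_ge0 C0 B0)) ?powR_ge0.
rewrite -ltNge => r2; have rgt0 : 0 < r by apply: lt_trans r2.
rewrite gE; last by rewrite ltW// (lt_trans _ r2)// (ltr_nat R 1 2).
rewrite /Rintegral; set I := (\int[_]_(_ in _) _)%E.
have integrandE (rho : R) : 1 <= rho -> rho <= r - 1 ->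
    g (r - rho) * (r - rho) `^ ((d%:R - 1) / 2) * g rho * rho `^ ((d%:R - 1) / 2)
    * h rho = (r - rho) `^ (a - 1) * rho `^ (a - 1) * h rho.
  by move=> rho1 rhor; rewrite -(gE rho)// -(gE (r - rho)); [ring|lra].
have I0 : (0 <= I)%E.
  apply: integral_ge0 => rho/=; rewrite in_itv/= => /andP[rho1 rhor].
  rewrite lee_fin integrandE// !mulr_ge0 ?powR_ge0//.
  by have /andP[] := hC rho (le_trans ler01 rho1).
have IC : (I <= (C * (r `^ (a + b - 1) * B))%:E)%E.
  rewrite EFinM [X in (_ * X)%E]EFinM -(pospowE (a + b) rgt0) -powconv1E// -powconvE.
  rewrite /powconv -ge0_integralZl_EFin//=; last 2 first.
  - by move=> t _; rewrite lee_fin mulr_ge0 ?pospow_ge0.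
  - apply/measurable_EFinP; exact: measurable_powconv_integrand.
  rewrite /I integral_mkcond; apply: ge0_le_integral_nomeas => rho _; rewrite patchE.
    case: ifP => // /set_mem/=; rewrite in_itv/= => /andP[rho1 rhor].
    rewrite lee_fin integrandE// !mulr_ge0 ?powR_ge0//.
    by have /andP[] := hC rho (le_trans ler01 rho1).
  case: ifPn => [/set_mem/=|_]; last by rewrite -EFinM lee_fin !mulr_ge0 ?pospow_ge0.
  rewrite in_itv/= => /andP[rho1 rhor].
  have rho0 : 0 < rho by apply: lt_le_trans rho1.
  rewrite -EFinM lee_fin integrandE// !pospowE//; last by lra.
  have /andP[_ hrho] := hC rho (ltW rho0).
  have -> : C * ((r - rho) `^ (a - 1) * rho `^ (b - 1)) =
            (r - rho) `^ (a - 1) * rho `^ (a - 1) * (C * rho `^ (b - a)).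
    have -> : b - 1 = (a - 1) + (b - a) by ring.
    by rewrite (@powRD _ rho (a - 1) (b - a)) ?(gt_eqF rho0) ?implybT//; ring.
  by rewrite ler_wpM2l// mulr_ge0 ?powR_ge0.
have Ifin : I \is a fin_num by rewrite ge0_fin_numE// (le_lt_trans IC)// ltry.
rewrite mulr_ge0 ?invr_ge0 ?powR_ge0 ?fine_ge0//= mulrC.
rewrite ler_pdivrMr ?powR_gt0// -lee_fin fineK//.
apply: le_trans IC _; rewrite lee_fin le_eqVlt; apply/orP; left; apply/eqP.
have -> : a + b - 1 = b + (a - 1) by ring.
by rewrite (@powRD _ r b (a - 1)) ?(gt_eqF rgt0) ?implybT//; ring.
Qed.

Lemma iter_H_step_bound (R : realType) (d : nat) (g : R -> R) (a : R) :
  0 < a ->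
  (forall r, 1 <= r -> g r * r `^ ((d%:R - 1) / 2) = r `^ (a - 1)) ->
  forall m r, 0 <= r ->
  0 <= iter m (H_step d g) (fun=> 1) r <=
    Gamma a ^+ m.+1 / Gamma (a * m.+1%:R) * r `^ (a * m.+1%:R - a).
Proof.
move=> a0 gE; elim=> [|m IH] r r0.
  by rewrite /= mulr1 subrr powRr0 mulr1 expr1 divff ?gt_eqF ?Gamma_gt0// ler01 lexx.
have b0 : 0 < a * m.+1%:R by rewrite mulr_gt0.
have C0 : 0 <= Gamma a ^+ m.+1 / Gamma (a * m.+1%:R).
  by rewrite divr_ge0 ?exprn_ge0 ?ltW ?Gamma_gt0.
have := H_step_bound a0 b0 C0 gE IH r0; rewrite iterS.
have -> : a * m.+2%:R = a + a * m.+1%:R by rewrite -[m.+2]add1n natrD; ring.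
rewrite (_ : _ + _ - a = a * m.+1%:R); last by ring.
congr (_ && (_ <= _ * _)); rewrite [in RHS]exprS.
by field; rewrite !gt_eqF ?Gamma_gt0 ?addr_gt0.
Qed.

Theorem lemma4p4 (R : realType) (d : nat) (gamma : R) (g : R -> R)
    (hd : (1 <= d)%N)
    (hgamma0 : 0 <= gamma) (hgamma1 : gamma < (d%:R + 1) / 2)
    (hg : (forall r : R, 0 < r -> g r = r `^ (- gamma)) \/
          (forall r : R, 0 <= r -> g r = (Num.max 1 r) `^ (- gamma)))
    (r : R) (hr : 0 <= r) (n : nat) (hn : (1 <= n)%N) :
  H d g n r <=
    Gamma ((d%:R + 1) / 2 - gamma) ^+ n
    / Gamma (((d%:R + 1) / 2 - gamma) * n%:R)
    * r `^ (((d%:R + 1) / 2 - gamma) * (n%:R - 1)).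
Proof.
have a0 : 0 < (d%:R + 1) / 2 - gamma by rewrite subr_gt0.
have gE s : 1 <= s ->
    g s * s `^ ((d%:R - 1) / 2) = s `^ ((d%:R + 1) / 2 - gamma - 1).
  move=> s1; have s0 : 0 < s by apply: lt_le_trans s1.
  have -> : g s = s `^ (- gamma).
    by case: hg => ->//; [rewrite (max_idPr s1)|rewrite ltW].
  by rewrite -powRD ?(gt_eqF s0) ?implybT//; congr (_ `^ _); field.
case: n hn => [//|m _].
have /andP[_] := iter_H_step_bound a0 gE m hr.
by rewrite /H [in X in _ -> X]mulrBr mulr1.
Qed.
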